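(* Let $n,m,N$ be positive integers, $p_1,\ldots,p_N,q_1,\ldots,q_N,g_1,\ldots,g_m\in\mathbb{R}[\mathbf{x}]$ with $\mathbf{x}=(x_1,\ldots,x_n)$, $\mathbf{K}=\{\mathbf{x}\in\mathbb{R}^n\mid g_j(\mathbf{x})\ge0,\ j\in[m]\}$ compact with $q_i>0$ on $\mathbf{K}$ for all $i\in[N]$, and $\rho=\inf_{\mathbf{x}\in\mathbf{K}}\sum_{i=1}^Np_i(\mathbf{x})/q_i(\mathbf{x})$. Suppose there are $I_1,\ldots,I_N\subseteq[n]$ and $J_1,\ldots,J_N\subseteq[m]$ with $[n]=\bigcup_iI_i$ and $[m]=\bigcup_iJ_i$ such that: (i) $p_i,q_i\in\mathbb{R}[\mathbf{x}(I_i)]$ for every $i$; (ii) $g_j\in\mathbb{R}[\mathbf{x}(I_i)]$ for every $j\in J_i$; (iii) for every $i$ there is $k\in J_i$ with $g_k=M_i-\sum_{\ell\in I_i}x_\ell^2$ for some $M_i>0$; (iv) for every $i\in\{2,\ldots,N\}$, $I_i\cap\bigcup_{j=1}^{i-1}I_j\subseteq I_k$ for some $k\in[i-1]$. Assume also $q_i>0$ on $\mathbf{K}_i$ for all $i\in[N]$. Then $\rho^{\mathrm{cs}}=\rho$, where \[ \rho^{\mathrm{cs}}=\inf\Big\{\sum_{i=1}^N\int_{\mathbf{K}_i}p_i\,\mathrm{d}\mu_i\ \Big|\ \mu_i\in\mathcal{M}(\mathbf{K}_i)_+^{\mathcal{R}},\ \int_{\mathbf{K}_i}q_i\,\mathrm{d}\mu_i=1\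 (i\in[N]),\ \pi_{ij}(q_i\,\mathrm{d}\mu_i)=\pi_{ji}(q_j\,\mathrm{d}\mu_j)\ (j\in U_i,\ i\in[N-1])\Big\}. \]
   Context: $\mathbf{x}(I)=\{x_\ell\mid\ell\in I\}$. $\mathbf{K}_i=\{\mathbf{z}\in\mathbb{R}^{I_i}\mid g_j(\mathbf{z})\ge0,\ j\in J_i\}$. $U_i=\{j\in\{i+1,\ldots,N\}\mid I_i\cap I_j\ne\emptyset\}$ ($i<N$). For a measure $\mu_i$ on $\mathbf{K}_i$, $q_i\,\mathrm{d}\mu_i$ is the measure with density $q_i$ with respect to $\mu_i$, and $\pi_{ij}(q_i\,\mathrm{d}\mu_i)$ is its image (marginal) under the coordinate projection $\mathbb{R}^{I_i}\to\mathbb{R}^{I_i\cap I_j}$. Let $\mathcal{A}=\bigcup_{i=1}^N(\operatorname{supp}p_i\cup\operatorname{supp}q_i)\cup\bigcup_{j=1}^m\operatorname{supp}g_j$ (supports = exponents of monomials with nonzero coefficients), and $\mathcal{R}=\{\mathbf{r}\in\{0,1\}^n\mid\mathbf{r}^\intercal\boldsymbol{\alpha}\equiv0\ (\mathrm{mod}\,2)\ \forall\boldsymbol{\alpha}\in\mathcal{A}\}$. For $\mathbf{r}\in\mathcal{R}$, $\mathbf{r}$ acts on $\mathbb{R}^{I_i}$ by $z_\ell\mapsto(-1)^{r_\ell}z_\ell$; for a measure $\mu$ on $\mathbf{K}_i$, $\mu^{\mathbf{r}}(S)=\mu(\mathbf{r}(S))$. $\mathcal{M}(\mathbf{K}_i)^{\mathcal{R}}_+$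 is the set of finite positive Borel measures on $\mathbf{K}_i$ with $\mu^{\mathbf{r}}=\mu$ for all $\mathbf{r}\in\mathcal{R}$. *)

(* Defs.v *)
From HB Require Import structures.
From mathcomp Require Import all_boot all_order all_algebra.
From mathcomp Require Import all_classical all_reals all_analysis.
From mathcomp Require mpoly.
(* mpoly's notations clash with mathcomp-analysis: import only its
   canonical instances and names; all mpoly names below are qualified. *)
Import -(notations) mpoly.

Set Implicit Arguments.
Unset Strict Implicit.
Unset Printing Implicit Defensive.

Import Order.TTheory GRing.Theory Num.Theory.
Local Open Scope classical_set_scope.
Local Open Scope ring_scope.

Notation poly_n R n := (mpoly.mpoly n R).

Definition expo n (a : mpoly.multinom n) (l : 'I_n) : nat :=
  tnth (mpoly.multinom_val a) l.

Definition poly_in_vars (R : realType) n (I : {set 'I_n}) (p : poly_n R n) :=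
  forall a : mpoly.multinom n, a \in mpoly.msupp p -> forall l, l \notin I -> expo a l = 0%N.

(* The space R^I is encoded as #|I|.-tuple R : the k-th coordinate of a
   tuple corresponds to the k-th element (enum_val k) of I, in increasing
   order. *)

(* extension of z in R^I to a point of R^n (zero outside I); only used to
   evaluate polynomials in R[x(I)], which do not depend on the coordinates
   outside I *)
Definition extI (R : realType) n (I : {set 'I_n}) (z : #|I|.-tuple R)
  : 'I_n -> R :=
  fun l => match boolP (l \in I) with
           | AltTrue h => tnth z (enum_rank_in h l)
           | AltFalse _ => 0
           end.

Definition coord_proj (R : realType) n (I J : {set 'I_n}) (z : #|I|.-tuple R)
  : #|J|.-tuple R :=
  [tuple extI z (@enum_val _ (mem J) k) | k < #|J|].

Definition Kset (R : realType) n m (g : 'I_m -> poly_n R n) : set ('I_n -> R) :=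
  [set x | forall j, 0 <= mpoly.meval x (g j)].

Definition Kloc (R : realType) n m (g : 'I_m -> poly_n R n)
  (I : {set 'I_n}) (J : {set 'I_m}) : set (#|I|.-tuple R) :=
  [set z | forall j, j \in J -> 0 <= mpoly.meval (extI z) (g j)].

Definition in_supp_data (R : realType) n m N (p q : 'I_N -> poly_n R n)
  (g : 'I_m -> poly_n R n) (a : mpoly.multinom n) : Prop :=
  (exists i, a \in mpoly.msupp (p i) \/ a \in mpoly.msupp (q i)) \/
  (exists j, a \in mpoly.msupp (g j)).

Definition sign_sym (R : realType) n m N (p q : 'I_N -> poly_n R n)
  (g : 'I_m -> poly_n R n) (r : 'I_n -> bool) : Prop :=
  forall a : mpoly.multinom n, in_supp_data p q g a ->
    ~~ odd (\sum_(l < n) (r l : nat) * expo a l)%N.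

Definition sign_act (R : realType) n (I : {set 'I_n}) (r : 'I_n -> bool)
  (z : #|I|.-tuple R) : #|I|.-tuple R :=
  [tuple (if r (enum_val k) then - tnth z k else tnth z k) | k < #|I|].

Definition Uset n N (I : 'I_N -> {set 'I_n}) (i : 'I_N) : {set 'I_N} :=
  [set j : 'I_N | (i < j)%N && (I i :&: I j != finset.set0)].

Definition ball_poly (R : realType) n (I : {set 'I_n}) (M : R) : poly_n R n :=
  mpoly.mpolyC n M - \sum_(l in I) (mpoly.mpolyX R (mpoly.mnm1 l)) ^+ 2.

Arguments extI {R n} I z l.
Arguments coord_proj {R n} I J z.
Arguments sign_act {R n} I r z.
Arguments Kloc {R n m} g I J.

Local Open Scope ereal_scope.

Definition rho (R : realType) n m N (p q : 'I_N -> poly_n R n)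
  (g : 'I_m -> poly_n R n) : \bar R :=
  ereal_inf [set (\sum_(i < N) mpoly.meval x (p i) / mpoly.meval x (q i))%R%:E
            | x in Kset g].

(* the measures mu_i : mu i is a finite positive Borel measure on R^{I_i}
   carried by K_i (i.e. a finite Borel measure on K_i) *)
Definition meas_family (R : realType) n N (I : 'I_N -> {set 'I_n}) :=
  forall i : 'I_N, {finite_measure set (#|I i|.-tuple R) -> \bar R}.

Definition feasible (R : realType) n m N (p q : 'I_N -> poly_n R n)
  (g : 'I_m -> poly_n R n) (I : 'I_N -> {set 'I_n}) (J : 'I_N -> {set 'I_m})
  (mu : meas_family R I) : Prop :=
  (forall i, mu i (~` Kloc g (I i) (J i)) = 0) /\
  (forall i (r : 'I_n -> bool), sign_sym p q g r ->
     forall S, measurable S -> mu i (sign_act (I i) r @` S) = mu i S) /\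
  (forall i, \int[mu i]_(z in Kloc g (I i) (J i))
                (mpoly.meval (extI (I i) z) (q i))%:E = 1) /\
  (forall i j, j \in Uset I i ->
     forall A : set (#|I i :&: I j|.-tuple R), measurable A ->
       \int[mu i]_(z in Kloc g (I i) (J i) `&`
                        (coord_proj (I i) (I i :&: I j) @^-1` A))
          (mpoly.meval (extI (I i) z) (q i))%:E =
       \int[mu j]_(z in Kloc g (I j) (J j) `&`
                        (coord_proj (I j) (I i :&: I j) @^-1` A))
          (mpoly.meval (extI (I j) z) (q j))%:E).

Arguments feasible {R n m N} p q g I J mu.

Definition rho_cs (R : realType) n m N (p q : 'I_N -> poly_n R n)
  (g : 'I_m -> poly_n R n) (I : 'I_N -> {set 'I_n}) (J : 'I_N -> {set 'I_m})
  : \bar R :=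
  ereal_inf [set s | exists mu : meas_family R I, feasible p q g I J mu /\
     s = \sum_(i < N) \int[mu i]_(z in Kloc g (I i) (J i))
                        (mpoly.meval (extI (I i) z) (p i))%:E].

(* Main.v *)
(* [rho_cs <= rho]: a point x of K yields the measures mu_i obtained by
   averaging the Dirac masses at the sign flips r x restricted to I_i and
   dividing by q_i(x); since p, q, g are invariant under the flips, the cost of
   this family is sum_i p_i(x)/q_i(x).

   [rho <= rho_cs]: instead of gluing the measures q_i dmu_i into one measure
   on K, cut the coordinates into finitely many cells of mesh delta. The cell
   masses of the q_i dmu_i have consistent marginals, and dynamic programming
   along the tree given by the running intersection property (eliminating the
   last index by minimising over the cells compatible with its parent) finds
   points z_i in K_i lying in common cells on the overlaps, whose total cost
   exceeds sum_i int p_i dmu_i by at most delta. As delta tends to 0, a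
   cluster point of these families is consistent, hence a point of K. *)
Require Import Defs.
From HB Require Import structures.
From mathcomp Require Import all_boot all_order all_algebra.
From mathcomp Require Import all_classical all_reals all_analysis.
From mathcomp Require mpoly.
Import (canonicals) mpoly.
From mathcomp Require Import measurable_realfun ring lra.
Import Order.TTheory GRing.Theory Num.Theory.
Import numFieldNormedType.Exports.
Local Open Scope classical_set_scope.
Local Open Scope ring_scope.

(** * Dynamic programming over finitely many cells *)

(** All restrictions share one type, with the filler [e0] off [S], so that marginals become sums
    over the fibres of a boolean equality. *)
Definition restrict_coords {n : nat} {E : finType} (e0 : E) (S : {set 'I_n})
    (c : {ffun 'I_n -> E}) : {ffun 'I_n -> E} :=
  [ffun l => if l \in S then c l else e0].

Lemma restrict_coords_eqP {n : nat} {E : finType} {e0 : E} {S : {set 'I_n}}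
    {c d : {ffun 'I_n -> E}} :
  reflect {in S, c =1 d} (restrict_coords e0 S c == restrict_coords e0 S d).
Proof.
apply: (iffP eqP) => [/ffunP cd l lS | cd].
  by have := cd l; rewrite !ffunE lS.
by apply/ffunP => l; rewrite !ffunE; case: ifP => // /cd.
Qed.

(** Induction on [t] for all [H] at once, since each step alters the costs. The last index is
    eliminated: its least cost over the cells compatible with its parent [k] is added to the cost of
    [k]. Equal marginals on the overlap allow this minimum to be averaged with the weights of either
    index. *)
Lemma tree_sum_lower_bound (R : realFieldType) (n N : nat) (E : finType)
    (e0 : E) (I : 'I_N -> {set 'I_n}) (w : 'I_N -> {ffun 'I_n -> E} -> R) :
  (forall i c, 0 <= w i c) -> (forall i, \sum_c w i c = 1) ->
  (forall i j b,
     \sum_(c | restrict_coords e0 (I i :&: I j)%SET c == b) w i c =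
     \sum_(c | restrict_coords e0 (I i :&: I j)%SET c == b) w j c) ->
  (forall i : 'I_N, (0 < i)%N -> exists2 k : 'I_N, (k < i)%N &
     (I i :&: \bigcup_(j < N | (j < i)%N) I j \subset I k)%SET) ->
  forall t, (t < N)%N -> forall (H : 'I_N -> {ffun 'I_n -> E} -> R) a,
  (forall c : 'I_N -> {ffun 'I_n -> E},
     (forall i : 'I_N, (i <= t)%N -> 0 < w i (c i)) ->
     (forall i j : 'I_N, (i <= t)%N -> (j <= t)%N ->
        {in (I i :&: I j)%SET, c i =1 c j}) ->
     a <= \sum_(i < N | (i <= t)%N) H i (c i)) ->
  a <= \sum_(i < N | (i <= t)%N) \sum_c w i c * H i c.
Proof.
move=> w0 w1 wI RIP; elim=> [|t IH] tN H a Ha.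
  pose o := Ordinal tN.
  have eqo (F : 'I_N -> R) : \sum_(i < N | (i <= 0)%N) F i = F o.
    rewrite (bigD1 o) //= big1 ?addr0 // => i /andP[i0 /eqP]; case.
    by apply/val_inj => /=; apply/eqP; rewrite -leqn0.
  rewrite eqo -[a]mul1r -(w1 o) mulr_suml; apply: ler_sum => c _.
  have := w0 o c; rewrite le_eqVlt => /orP[/eqP <-|wc]; first by rewrite !mul0r.
  rewrite ler_pM2l //; have := Ha (fun=> c); rewrite eqo; apply=> // i.
  rewrite leqn0 => /eqP i0; suff -> : i = o by [].
  exact: val_inj.
pose o := Ordinal tN.
have [//|k ko kS] := RIP o.
have kt : (k <= t)%N by [].
have spl (F : 'I_N -> R) : \sum_(i < N | (i <= t.+1)%N) F i =
    F o + \sum_(i < N | (i <= t)%N) F i.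
  rewrite (bigD1 o) //=; congr (_ + _); apply: eq_bigl => i.
  by rewrite -val_eqE /= andbC -ltn_neqAle ltnS.
set S := (I k :&: I o)%SET.
pose res := restrict_coords e0 S.
(* Candidates are the cells of positive weight for the last index that restrict to [b] on the
   overlap with its parent. *)
pose cand b c := (0 < w o c) && (res c == b).
have [psi psiP] : exists psi : {ffun 'I_n -> E} -> {ffun 'I_n -> E},
    forall b c, cand b c -> cand b (psi b) /\ H o (psi b) <= H o c.
  (* A cheapest candidate; the value [b] is a dummy for fibres without candidates. *)
  exists (fun b => if [pick c | cand b c] is Some c0 then
     [arg min_(c < c0 | cand b c) H o c]%O else b) => b c bc.
  case: pickP => [c0 bc0|/(_ c)]; last by rewrite bc.
  by case: arg_minP => // c1 bc1 /(_ c bc).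
pose phi b := H o (psi b).
pose H' i c := if i == k then H i c + phi (res c) else H i c.
have addk (F : 'I_N -> R) x :
    \sum_(i < N | (i <= t)%N) (if i == k then F i + x else F i) =
    x + \sum_(i < N | (i <= t)%N) F i.
  rewrite (bigD1 k) //= eqxx [in RHS](bigD1 k) //= addrCA addrA; congr (_ + _).
  by apply: eq_bigr => i /andP[_ /negPf ->].
have {}IH : a <= \sum_(i < N | (i <= t)%N) \sum_c w i c * H' i c.
  apply: IH; first exact: ltnW.
  move=> c cpos cagr.
  (* The cell [c k] has positive weight, so its fibre has positive mass for [k], hence also for
     [o]. *)
  have ex : exists c', cand (res (c k)) c'.
    apply/existsP; apply: contraT => /existsPn nocand.
    suff : 0 < \sum_(c' | res c' == res (c k)) w k c'.
      rewrite (wI k o) big1 ?ltxx // => c' rc'; have := nocand c'.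
      rewrite /cand rc' andbT => nw; apply/eqP.
      by rewrite eq_le w0 andbT leNgt.
    rewrite (bigD1 (c k)) //= ltr_pwDl ?cpos //; exact: sumr_ge0.
  have [c' cc'] := ex.
  have [/andP[wpsi /(restrict_coords_eqP) rpsi] _] := psiP _ _ cc'.
  pose c2 i := if i == o then psi (res (c k)) else c i.
  have c2o : c2 o = psi (res (c k)) by rewrite /c2 eqxx.
  have c2n (i : 'I_N) : (i <= t)%N -> c2 i = c i.
    by rewrite /c2; case: eqP => // -> /=; rewrite ltnn.
  have tcase (i : 'I_N) : (i <= t.+1)%N -> i = o \/ (i <= t)%N.
    rewrite leq_eqVlt ltnS => /orP[/eqP it|]; last by right.
    by left; apply: val_inj.
  have := Ha c2; rewrite spl c2o.
  rewrite (eq_bigr (fun i => H i (c i))) => [|i it]; last by rewrite c2n.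
  rewrite (_ : \sum_(i < N | (i <= t)%N) H' i (c i) =
    \sum_(i < N | (i <= t)%N)
      (if i == k then H i (c i) + phi (res (c k)) else H i (c i))); last first.
    by apply: eq_bigr => i _; rewrite /H'; case: eqP => // ->.
  rewrite addk; apply.
    by move=> i /tcase[->|it]; rewrite ?c2o ?c2n ?cpos.
  (* Running intersection: a coordinate shared by [I o] and [I j] lies in [I k], where [c2 o] agrees
     with [c k], and [c k] with [c j]. *)
  have agro (j : 'I_N) : (j <= t)%N -> {in (I o :&: I j)%SET, c2 o =1 c j}.
    move=> jt l; rewrite inE => /andP[lo lj].
    have lk : l \in I k.
      apply: (fintype.subsetP kS); rewrite inE lo /=; apply/bigcupP; exists j => //.
    rewrite c2o rpsi ?inE ?lk ?lo //; apply: cagr => //.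
    by rewrite inE lk lj.
  move=> i j /tcase[->|it] /tcase[->|jt] l lij //.
  - by rewrite (c2n j) // (agro j).
  - by rewrite (c2n i) // (agro i) // finset.setIC.
  - by rewrite !c2n // (cagr i j).
apply: le_trans IH _; rewrite spl.
rewrite (_ : \sum_(i < N | (i <= t)%N) \sum_c w i c * H' i c =
  \sum_(i < N | (i <= t)%N) (if i == k then \sum_c w i c * H i c + \sum_c w k c * phi (res c)
   else \sum_c w i c * H i c)); last first.
  apply: eq_bigr => i _; rewrite /H'; case: eqP => // ->.
  by rewrite -big_split; apply: eq_bigr => c _; rewrite mulrDr.
rewrite addk lerD2r.
(* The factor [phi (res c)] is constant on each fibre, and fibres have equal mass for [k] and
   [o]. *)
have -> : \sum_c w k c * phi (res c) = \sum_c w o c * phi (res c).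
  rewrite (partition_big res predT) //= [RHS](partition_big res predT) //=.
  apply: eq_bigr => b _.
  transitivity ((\sum_(c | res c == b) w k c) * phi b).
    by rewrite mulr_suml; apply: eq_bigr => c /eqP <-.
  by rewrite (wI k o) mulr_suml; apply: eq_bigr => c /eqP <-.
apply: ler_sum => c _.
have := w0 o c; rewrite le_eqVlt => /orP[/eqP <-|wc]; first by rewrite !mul0r.
by rewrite ler_pM2l //; apply: (psiP (res c) c _).2; rewrite /cand wc /=.
Qed.

(** * Evaluation of polynomials on blocks of coordinates *)

(** Polynomials arise from constants and coordinates by sums and products. Measurability,
    boundedness and continuity of evaluation are all instances. *)
Lemma meval_closed {R : realType} {n : nat} {T : Type} (P : (T -> R) -> Prop)
    (F : T -> 'I_n -> R) (p : poly_n R n) :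
  (forall c, P (fun=> c)) ->
  (forall f h, P f -> P h -> P (fun t => f t + h t)) ->
  (forall f h, P f -> P h -> P (fun t => f t * h t)) ->
  (forall l, P (F ^~ l)) -> P (fun t => mpoly.meval (F t) p).
Proof.
move=> Pc Pa Pm PF.
rewrite (_ : (fun t => _) = (fun t => \sum_(m <- mpoly.msupp p)
   mpoly.mcoeff m p * \prod_i F t i ^+ expo m i)); last first.
  by apply/funext => t; rewrite mpoly.mevalE.
elim: (mpoly.msupp p) => [|m s IH].
  by under eq_fun do rewrite big_nil; exact: Pc.
under eq_fun do rewrite big_cons; apply: (Pa) IH; apply: (Pm) => //.
elim: (index_enum _) => [|l e IH].
  by under eq_fun do rewrite big_nil; exact: Pc.
under eq_fun do rewrite big_cons; apply: (Pm) IH.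
elim: (expo m l) => [|k IH]; first by under eq_fun do rewrite expr0; exact: Pc.
by under eq_fun do rewrite exprS; exact: Pm.
Qed.

Lemma eq_meval_in {R : realType} {n : nat} {I : {set 'I_n}} (p : poly_n R n)
    (x y : 'I_n -> R) :
  poly_in_vars I p -> {in I, x =1 y} -> mpoly.meval x p = mpoly.meval y p.
Proof.
move=> pI xy; rewrite !mpoly.mevalE; apply: eq_big_seq => a ap.
congr (_ * _); apply: eq_bigr => l _.
have [lI|lI] := boolP (l \in I); first by rewrite xy.
by rewrite -[mpoly.fun_of_multinom a l]/(expo a l) (pI a ap l lI) !expr0.
Qed.

Definition flip {R : realType} {n : nat} (r : 'I_n -> bool) (x : 'I_n -> R) :
    'I_n -> R :=
  fun l => (-1) ^+ r l * x l.

(** The flip multiplies the monomial of exponent [a] by a power of -1 whose exponent, the pairing of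
    [r] with [a], is even. *)
Lemma meval_flip {R : realType} {n : nat} (p : poly_n R n) (r : 'I_n -> bool)
    (x : 'I_n -> R) :
  {in mpoly.msupp p, forall a, ~~ odd (\sum_(l < n) (r l : nat) * expo a l)%N} ->
  mpoly.meval (flip r x) p = mpoly.meval x p.
Proof.
move=> pr; rewrite !mpoly.mevalE; apply: eq_big_seq => a ap.
congr (_ * _).
under eq_bigr do
  rewrite /flip exprMn -[mpoly.fun_of_multinom a _]/(expo a _) -exprM.
by rewrite big_split /= prodrXr -signr_odd (negPf (pr a ap)) mul1r.
Qed.

Lemma extI_enum_val {R : realType} {n : nat} {I : {set 'I_n}}
    (z : #|I|.-tuple R) (k : 'I_#|I|) : extI I z (enum_val k) = tnth z k.
Proof.
rewrite /extI; refine (match boolP _ as s return match s with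
  | AltTrue h => tnth z (enum_rank_in h (enum_val k)) | AltFalse _ => 0 end = _
  with AltTrue h => _ | AltFalse h => _ end).
  by rewrite enum_valK_in.
by rewrite enum_valP in h.
Qed.

Lemma extI_notin {R : realType} {n : nat} {I : {set 'I_n}} (z : #|I|.-tuple R)
    (l : 'I_n) : l \notin I -> extI I z l = 0.
Proof.
move=> lI; rewrite /extI; refine (match boolP _ as s return match s with
  | AltTrue h => tnth z (enum_rank_in h l) | AltFalse _ => 0 end = 0
  with AltTrue h => _ | AltFalse h => _ end) => //.
by rewrite h in lI.
Qed.

Lemma extI_mktuple {R : realType} {n : nat} {I : {set 'I_n}} (x : 'I_n -> R) :
  {in I, extI I [tuple x (enum_val k) | k < #|I|] =1 x}.
Proof. by move=> l lI; rewrite -(enum_rankK_in lI lI) extI_enum_val tnth_mktuple. Qed.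

Lemma extI_coord_proj {R : realType} {n : nat} {I S : {set 'I_n}}
    (z : #|I|.-tuple R) : {in S, extI S (coord_proj I S z) =1 extI I z}.
Proof. exact: extI_mktuple. Qed.

Lemma measurable_extI {R : realType} {n : nat} (I : {set 'I_n}) (l : 'I_n) :
  measurable_fun setT (fun z : #|I|.-tuple R => extI I z l).
Proof.
have [lI|lI] := boolP (l \in I).
  rewrite -(enum_rankK_in lI lI).
  by under eq_fun do rewrite extI_enum_val; exact: measurable_tnth.
by under eq_fun do rewrite extI_notin //; exact: measurable_cst.
Qed.

Lemma measurable_meval_extI {R : realType} {n : nat} (I : {set 'I_n})
    (p : poly_n R n) :
  measurable_fun setT (fun z : #|I|.-tuple R => mpoly.meval (extI I z) p).
Proof.
apply: (meval_closed (measurable_fun [set: #|I|.-tuple R])).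
- by move=> c; exact: measurable_cst.
- by move=> f h mf mh; exact: measurable_funD.
- by move=> f h mf mh; exact: measurable_funM.
- by move=> l; exact: measurable_extI.
Qed.

Lemma measurable_Kloc {R : realType} {n m : nat} (g : 'I_m -> poly_n R n)
    (I : {set 'I_n}) (J : {set 'I_m}) : measurable (Kloc g I J).
Proof.
rewrite (_ : Kloc g I J = \bigcap_(j in [set` J])
   ((fun z : #|I|.-tuple R => mpoly.meval (extI I z) (g j)) @^-1` `[0, +oo[)).
  apply: fin_bigcap_measurable => // j _.
  by rewrite -[X in measurable X]setTI; exact: measurable_meval_extI.
apply/seteqP; split=> z Kz j jJ; have := Kz j jJ;
  by rewrite /= in_itv /= andbT.
Qed.

Lemma measurable_coord_proj {R : realType} {n : nat} (I S : {set 'I_n}) :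
  measurable_fun setT (coord_proj I S : #|I|.-tuple R -> _).
Proof.
apply/measurable_fun_tnthP => k.
rewrite (_ : _ \o _ = (fun z : #|I|.-tuple R => extI I z (@enum_val _ (mem S) k))).
  exact: measurable_extI.
by apply/funext => z /=; rewrite tnth_mktuple.
Qed.

(** * Orbit measures under sign flips and the bound [rho_cs <= rho] *)

Section atomic_measure.
Context {d} {T : measurableType d} {R : realType}.
Variables (k : {nonneg R}) (x0 : T) (s : seq T).

(** Repetitions in [s] count, so an orbit can be listed by its flips even when several flips give
    the same point; [x0] is only the default of [nth]. *)
Definition atomic : set T -> \bar R :=
  mscale k (msum (fun i => \d_(nth x0 s i)) (size s)).

HB.instance Definition _ := Measure.on atomic.

Lemma atomicE (A : set T) :
  atomic A = (k%:num%:E * \sum_(x <- s) \d_x A)%E.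
Proof. by rewrite /atomic /mscale /msum (big_nth x0) big_mkord. Qed.

Let fin_num_atomic : fin_num_fun atomic.
Proof.
move=> A mA; rewrite atomicE fin_numM // sum_fin_num; apply/allP => ? /mapP[x _ ->].
by have := fin_num_measure (\d_x : {finite_measure set T -> \bar R}) A mA.
Qed.

HB.instance Definition _ :=
  @Measure_isFinite.Build d T R atomic fin_num_atomic.

End atomic_measure.

(** Meant for orbit measures: an invariant polynomial is constant on the atoms, hence almost
    everywhere. *)
Lemma integral_ae_const d (T : measurableType d) (R : realType)
    (mu : {measure set T -> \bar R}) (D : set T) (f : T -> R) (c : R) :
  measurable D -> measurable_fun setT f -> mu [set z | f z != c] = 0%E ->
  (\int[mu]_(z in D) (f z)%:E = c%:E * mu D)%E.
Proof.
move=> mD mf fc; rewrite -integral_cst //.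
apply: ae_eq_integral => //.
- by apply/measurable_EFinP; apply: measurable_funS mf.
- exists [set z | f z != c]; split=> //.
    rewrite (_ : [set z | _] = f @^-1` (~` [set c])).
      by rewrite -[X in measurable X]setTI; apply: mf => //; exact: measurableC.
    by apply/seteqP; split=> z /= /eqP.
  move=> z /= fz; apply/eqP => fzc; apply: fz => _.
  by rewrite fzc.
Qed.

Definition xor_flips {n : nat} (r s : {ffun 'I_n -> bool}) : {ffun 'I_n -> bool} :=
  [ffun l => s l (+) r l].

Lemma xor_flipsK {n : nat} (r : {ffun 'I_n -> bool}) : involutive (xor_flips r).
Proof. by move=> s; apply/ffunP => l; rewrite !ffunE addbK. Qed.

(** The parity of the pairing of [r] with an exponent is additive in [r] for exclusive or. *)
Lemma sign_sym_xor {R : realType} {n m N : nat} (p q : 'I_N -> poly_n R n)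
    (g : 'I_m -> poly_n R n) (r s : {ffun 'I_n -> bool}) :
  sign_sym p q g r -> sign_sym p q g s -> sign_sym p q g (xor_flips r s).
Proof.
have oddE (t : {ffun 'I_n -> bool}) a : odd (\sum_(l < n) (t l : nat) * expo a l)%N =
    \big[addb/false]_(l < n) (t l && odd (expo a l)).
  by rewrite (big_morph odd oddD erefl); apply: eq_bigr => l _; rewrite oddM oddb.
move=> rs ss a aS; have := ss a aS; have := rs a aS; rewrite !oddE.
have -> : \big[addb/false]_(l < n) (xor_flips r s l && odd (expo a l)) =
   \big[addb/false]_(l < n) (s l && odd (expo a l)) (+)
   \big[addb/false]_(l < n) (r l && odd (expo a l)).
  by rewrite -big_split; apply: eq_bigr => l _; rewrite ffunE andb_addl.
by move=> /negPf -> /negPf ->.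
Qed.

Definition orbit_point {R : realType} {n : nat} (I : {set 'I_n}) (x : 'I_n -> R)
    (r : {ffun 'I_n -> bool}) : #|I|.-tuple R :=
  [tuple flip r x (enum_val k) | k < #|I|].

Lemma sign_act_orbit_point {R : realType} {n : nat} (I : {set 'I_n})
    (x : 'I_n -> R) (r s : {ffun 'I_n -> bool}) :
  sign_act I r (orbit_point I x s) = orbit_point I x (xor_flips r s).
Proof.
apply: eq_from_tnth => k; rewrite !tnth_mktuple /flip ffunE.
by case: (r _); case: (s _); rewrite /= ?expr1 ?expr0; ring.
Qed.

Lemma sign_actK {R : realType} {n : nat} (I : {set 'I_n}) (r : 'I_n -> bool) :
  involutive (sign_act I r : #|I|.-tuple R -> _).
Proof.
move=> z; apply: eq_from_tnth => k; rewrite !tnth_mktuple.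
by case: (r _); rewrite ?opprK.
Qed.

Lemma coord_proj_orbit_point {R : realType} {n : nat} (I S : {set 'I_n})
    (x : 'I_n -> R) (r : {ffun 'I_n -> bool}) :
  S \subset I -> coord_proj I S (orbit_point I x r) = orbit_point S x r.
Proof.
move=> SI; apply: eq_from_tnth => k; rewrite !tnth_mktuple extI_mktuple //.
by apply: (fintype.subsetP SI); exact: enum_valP.
Qed.

Lemma rho_cs_le_point {R : realType} {n m N : nat}
  (p q : 'I_N -> poly_n R n) (g : 'I_m -> poly_n R n)
  (I : 'I_N -> {set 'I_n}) (J : 'I_N -> {set 'I_m}) (x : 'I_n -> R) :
  (forall i, 0 < mpoly.meval x (q i)) ->
  (forall i, poly_in_vars (I i) (p i) /\ poly_in_vars (I i) (q i)) ->
  (forall i j, j \in J i -> poly_in_vars (I i) (g j)) ->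
  Kset g x ->
  (rho_cs p q g I J <= (\sum_(i < N) mpoly.meval x (p i) / mpoly.meval x (q i))%:E)%E.
Proof.
move=> q_gt0 pqI gI Kx.
pose sym : {set {ffun 'I_n -> bool}} := [set r : {ffun 'I_n -> bool} | `[< sign_sym p q g r >]]%SET.
have symP (r : {ffun 'I_n -> bool}) : reflect (sign_sym p q g r) (r \in sym).
  by rewrite inE; exact: asboolP.
pose s := enum sym.
pose r0 : {ffun 'I_n -> bool} := [ffun => false].
have s_gt0 : 0 < (#|sym|%:R : R).
  rewrite ltr0n card_gt0; apply/set0Pn; exists r0; apply/symP => a _.
  by rewrite big1 // => l _; rewrite ffunE mul0n.
have k_ge0 i : 0 <= (#|sym|%:R * mpoly.meval x (q i))^-1.
  by rewrite invr_ge0 mulr_ge0 // ltW.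
(* Dividing by the value of [q i] at [x] makes [q_i dmu_i] the uniform probability on the flips for
   every [i]; this yields both total mass 1 and consistent marginals. *)
pose mu : meas_family R I := fun i =>
  atomic (NngNum (k_ge0 i)) (orbit_point (I i) x r0) (map (orbit_point (I i) x) s).
have muE i A : mu i A = ((#|sym|%:R * mpoly.meval x (q i))^-1%:E *
    \sum_(r in sym) \d_(orbit_point (I i) x r) A)%E.
  by rewrite /mu /= atomicE big_map big_enum.
have evalE i r f : r \in sym -> poly_in_vars (I i) f ->
    (forall a, a \in mpoly.msupp f -> in_supp_data p q g a) ->
    mpoly.meval (extI (I i) (orbit_point (I i) x r)) f = mpoly.meval x f.
  move=> /symP rs fI fS; rewrite (eq_meval_in _ _ (flip r x) fI) ?meval_flip //.
    by move=> a /fS /rs.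
  exact: extI_mktuple.
have pE i r : r \in sym ->
    mpoly.meval (extI (I i) (orbit_point (I i) x r)) (p i) = mpoly.meval x (p i).
  by move=> rs; apply: evalE => //; [case: (pqI i)|move=> a ap; left; exists i; left].
have qE i r : r \in sym ->
    mpoly.meval (extI (I i) (orbit_point (I i) x r)) (q i) = mpoly.meval x (q i).
  by move=> rs; apply: evalE => //; [case: (pqI i)|move=> a ap; left; exists i; right].
have KE i r : r \in sym -> Kloc g (I i) (J i) (orbit_point (I i) x r).
  move=> rs j jJ; rewrite (evalE i r (g j)) //; first exact: gI.
  by move=> a ag; right; exists j.
have mu0 i A : (forall r, r \in sym -> ~ A (orbit_point (I i) x r)) -> mu i A = 0%E.
  move=> nA; rewrite muE big1 ?mule0 // => r rs.
  by rewrite diracE memNset //; exact: nA.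
have intE i f D : measurable D ->
    (forall r, r \in sym -> mpoly.meval (extI (I i) (orbit_point (I i) x r)) f = mpoly.meval x f) ->
    (\int[mu i]_(z in D) (mpoly.meval (extI (I i) z) f)%:E =
     (mpoly.meval x f)%:E * mu i D)%E.
  move=> mD fE; apply: integral_ae_const => //; first exact: measurable_meval_extI.
  by apply: mu0 => r rs /=; rewrite fE // eqxx.
have muK i : mu i (Kloc g (I i) (J i)) = (mpoly.meval x (q i))^-1%:E.
  rewrite muE (eq_bigr (fun=> 1%E)) => [|r rs]; last first.
    by rewrite diracE mem_set //; exact: KE.
  rewrite sumEFin -EFinM sumr_const; congr _%:E.
  by rewrite invfM mulrAC mulVf ?mul1r // gt_eqF.
apply: ereal_inf_lbound; exists mu; split; last first.
  rewrite -sumEFin; apply: eq_bigr => i _.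
  by rewrite intE ?muK //; [exact: measurable_Kloc|exact: pE].
split; [|split; [|split]].
- by move=> i; apply: mu0 => r rs; apply; exact: KE.
- move=> i r rS S mS; rewrite !muE; congr (_ * _)%E.
  pose r' : {ffun 'I_n -> bool} := [ffun l => r l].
  have r'E : r = r' :> ('I_n -> bool) by apply/funext => l; rewrite ffunE.
  have r's : r' \in sym by apply/symP; rewrite -r'E.
  have xs t : (xor_flips r' t \in sym) = (t \in sym).
    apply/idP/idP => [|] /symP ts; apply/symP; last exact/sign_sym_xor/ts/symP.
    by rewrite -(xor_flipsK r' t); apply/sign_sym_xor/ts/symP.
  (* Composition with [r'] permutes [sym], so it only reorders the sum over the orbit. *)
  rewrite (reindex_inj (inv_inj (xor_flipsK r'))) /=.
  apply: eq_big => [t|t _]; first exact: xs.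
  rewrite !diracE; congr (_%:R%:E); congr nat_of_bool; apply/idP/idP => /set_mem.
    move=> [z Sz] zE; apply/mem_set; suff <- : z = orbit_point (I i) x t by [].
    rewrite -(sign_actK (I i) r z) zE r'E -sign_act_orbit_point.
    exact: sign_actK.
  move=> St; apply/mem_set; exists (orbit_point (I i) x t) => //.
  by rewrite r'E sign_act_orbit_point.
- move=> i; rewrite intE ?muK; last exact: qE.
    by rewrite -EFinM divff // gt_eqF.
  exact: measurable_Kloc.
- move=> i j _ A mA.
  have mKA k : measurable (Kloc g (I k) (J k) `&`
      coord_proj (I k) (I i :&: I j)%SET @^-1` A : set (#|I k|.-tuple R)).
    apply: measurableI; first exact: measurable_Kloc.
    by rewrite -[X in measurable X]setTI; exact: measurable_coord_proj.
  (* The values of [q] cancel the weights, and both sides count the flips whose orbit point projects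
     into [A]; this projection is the same from either block. *)
  rewrite (intE i) ?(intE j) //; try exact: qE; try exact: mKA.
  rewrite !muE !muleA -!EFinM !invfM !(mulrCA (mpoly.meval x _)) !divff ?gt_eqF //.
  congr (_ * _)%E; apply: eq_bigr => r rs; rewrite !diracE.
  congr (_%:R%:E); congr nat_of_bool.
  have red k : (I i :&: I j)%SET \subset I k ->
    (orbit_point (I k) x r \in Kloc g (I k) (J k) `&`
      coord_proj (I k) (I i :&: I j)%SET @^-1` A) =
    (orbit_point (I i :&: I j)%SET x r \in A).
    move=> SI; apply/idP/idP => /set_mem.
      by move=> [_]; rewrite /= coord_proj_orbit_point // => /mem_set.
    move=> Ar; apply/mem_set; split; first exact: KE.
    by rewrite /= coord_proj_orbit_point.
  by rewrite !red ?subsetIl ?subsetIr.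
Qed.

(** * Finite grids and averaging over a cell *)

(** A cell records which thresholds [- B + delta * k] are at least [x]. If [x <= y] share a cell,
    the first threshold beyond [x] also bounds [y], and it is at most [x + delta]. *)
Lemma finite_grid {R : realType} (B delta : R) : 0 < delta ->
  exists (E : finType) (cell : R -> E),
    (forall e, measurable (cell @^-1` [set e])) /\
    forall x y, `|x| <= B -> `|y| <= B -> cell x = cell y -> `|x - y| <= delta.
Proof.
(* As [x <= B], the first threshold beyond [x] has index at most the truncation plus one, so it
   belongs to ['I_D]. *)
move=> d0; pose D := (Num.truncn (2 * B / delta)).+2.
exists {ffun 'I_D -> bool}, (fun x => [ffun k : 'I_D => x <= - B + delta * k%:R]).
split=> [e|].
  rewrite (_ : _ @^-1` _ = \bigcap_(k in [set: 'I_D])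
      (if e k then [set` `]-oo, (- B + delta * k%:R)]]
       else ~` [set` `]-oo, (- B + delta * k%:R)]])).
    apply: fin_bigcap_measurable => // k _.
    by case: (e k) => //; apply: measurableC.
  apply/seteqP; split=> x /=.
    move=> <- k _ /=; rewrite ffunE; case: ifPn; rewrite /= in_itv /= => //.
    by move=> /negP.
  move=> xe; apply/ffunP => k; rewrite ffunE; have := xe k I.
  by case: (e k); rewrite /= in_itv /= => // /negP/negPf.
move=> x y; wlog xy : x y / x <= y => [hw xB yB exy|].
  have [|/ltW] := leP x y => h; first exact: hw.
  by rewrite distrC; apply: hw.
rewrite !ler_norml => /andP[xB1 xB2] /andP[yB1 yB2] /ffunP exy.
have u0 : 0 <= (x + B) / delta by apply: divr_ge0; [lra|exact: ltW].
have /andP[t1 t2] := truncn_itv u0.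
have kD : ((Num.truncn ((x + B) / delta)).+1 < D)%N.
  rewrite !ltnS; apply: le_truncn; rewrite ler_pM2r ?invr_gt0 //; lra.
have := exy (Ordinal kD); rewrite !ffunE /=.
rewrite ler_pdivlMr // in t1; rewrite ltr_pdivrMr // in t2.
set k := (Num.truncn _) in t1 t2 *.
have -> : x <= - B + delta * k.+1%:R by lra.
move=> /esym yk; have {yk} : y <= - B + delta * k.+1%:R by [].
rewrite -natr1 => yk.
by apply/andP; split; lra.
Qed.

Lemma integral_finite_partition d (T : measurableType d) (R : realType)
    (mu : {measure set T -> \bar R}) (K : set T) (f : T -> R) (C : finType)
    (cell : T -> C) (Q : pred C) :
  measurable K -> (forall c, measurable (cell @^-1` [set c])) ->
  measurable_fun setT f ->
  (\int[mu]_(z in K `&` [set z | Q (cell z)]) (f z)%:E =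
   \sum_(c | Q c) \int[mu]_(z in K `&` cell @^-1` [set c]) (f z)%:E)%E.
Proof.
move=> mK mc mf.
have DE : K `&` [set z | Q (cell z)] =
    \big[setU/set0]_(c <- [seq c <- index_enum C | Q c]) (K `&` cell @^-1` [set c]).
  rewrite -bigcup_seq; apply/seteqP; split=> z /=.
    move=> [Kz Qz]; exists (cell z) => //=.
    by rewrite mem_filter Qz mem_index_enum.
  move=> [c /=]; rewrite mem_filter => /andP[Qc _] [Kz cz].
  by split=> //; rewrite cz.
rewrite DE integral_bigsetU_EFin.
- by rewrite big_filter.
- by move=> c; apply: measurableI.
- by rewrite filter_uniq // index_enum_uniq.
- apply/trivIsetP => c c' _ _ /eqP cc'; apply/seteqP; split=> z //=.
  move=> [[_ zc] [_ zc']]; by apply: cc'; rewrite -zc -zc'.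
- by apply/measurable_EFinP; apply: measurable_funS mf.
Qed.

(* Averaging: otherwise [p > (int p / int q + eta) q] on all of [K], and
   integrating gives [eta * int q <= 0]. *)
Lemma quotient_le_average d (T : measurableType d) (R : realType)
    (mu : {measure set T -> \bar R}) (K : set T) (p q : T -> R) (eta : R) :
  measurable K -> mu.-integrable K (EFin \o p) -> mu.-integrable K (EFin \o q) ->
  (forall z, K z -> 0 < q z) -> 0 < eta ->
  (0 < \int[mu]_(z in K) (q z)%:E)%E ->
  exists2 z, K z &
    (p z / q z) * fine (\int[mu]_(z in K) (q z)%:E) <=
    fine (\int[mu]_(z in K) (p z)%:E) + eta * fine (\int[mu]_(z in K) (q z)%:E).
Proof.
move=> mK ip iq q0 eta0.
set P := (\int[mu]_(z in K) (p z)%:E)%E; set W := (\int[mu]_(z in K) (q z)%:E)%E.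
have Pfin : P \is a fin_num by exact: integrable_fin_num.
have Wfin : W \is a fin_num by exact: integrable_fin_num.
rewrite -(fineK Wfin) lte_fin; set w := fine W => w0.
apply: contrapT => nz.
pose t := fine P / w + eta.
have tpq z : K z -> t * q z <= p z.
  move=> Kz; rewrite leNgt; apply/negP => pt; apply: nz; exists z => //.
  rewrite -ler_pdivlMr // mulrDl mulfK ?gt_eqF // ler_pdivrMr ?q0 //.
  exact: ltW.
have : (\int[mu]_(z in K) (t * q z)%:E <= P)%E.
  apply: le_integral => //.
    by have := integrableZl mK t iq; apply: eq_integrable.
  by move=> z /set_mem Kz; rewrite lee_fin tpq.
under eq_integral do rewrite EFinM.
rewrite integralZl // -/W -(fineK Wfin) -(fineK Pfin) -EFinM lee_fin -/w /t.
by rewrite mulrDl divfK ?gt_eqF // gerDl leNgt mulr_gt0.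
Qed.

(** A positive [q] has zero integral only if [K] is null. This handles the cells of zero mass. *)
Lemma integral_eq0_pos_weight d (T : measurableType d) (R : realType)
    (mu : {measure set T -> \bar R}) (K : set T) (p q : T -> R) :
  measurable K -> measurable_fun setT p -> measurable_fun setT q ->
  (forall z, K z -> 0 < q z) ->
  (\int[mu]_(z in K) (q z)%:E = 0)%E -> (\int[mu]_(z in K) (p z)%:E = 0)%E.
Proof.
move=> mK mp mq q0 W0.
have mEq : measurable_fun K (EFin \o q).
  by apply/measurable_EFinP; apply: measurable_funS mq.
have : (\int[mu]_(z in K) `|(EFin \o q) z| = 0)%E.
  rewrite -W0; apply: eq_integral => z /set_mem Kz /=.
  by rewrite ger0_norm // ltW // q0.
move=> /(ae_eq_integral_abs mu mK mEq) q_ae.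
rewrite -(integral0 mu K); apply: ae_eq_integral => //.
  by apply/measurable_EFinP; apply: measurable_funS mp.
apply: filterS q_ae => z qz Kz; have := q0 z Kz.
by have := qz Kz => /= -[->]; rewrite ltxx.
Qed.

(** * Bounded blocks and nearly consistent points *)

(** The ball constraint bounds the square of each coordinate by [|M|]; the bound [|M| + 1] on the
    coordinate itself avoids square roots. *)
Lemma Kloc_bounded {R : realType} {n m : nat} (g : 'I_m -> poly_n R n)
    (I : {set 'I_n}) (J : {set 'I_m}) (k : 'I_m) (M : R) :
  k \in J -> g k = ball_poly I M -> forall z, Kloc g I J z ->
  forall l, `|extI I z l| <= `|M| + 1.
Proof.
move=> kJ gk z Kz l; have [lI|lI] := boolP (l \in I); last first.
  by rewrite extI_notin // normr0 addr_ge0.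
have := Kz k kJ; rewrite gk /ball_poly mpoly.mevalB mpoly.mevalC
  (big_morph _ (mpoly.mevalD _) (mpoly.meval0 _)).
under eq_bigr do rewrite expr2 mpoly.mevalM mpoly.mevalXU -expr2.
rewrite (bigD1 l) //= opprD addrA => h.
have s0 : 0 <= \sum_(i in I | i != l) extI I z i ^+ 2.
  by apply: sumr_ge0 => i _; exact: sqr_ge0.
have sq : `|extI I z l| ^+ 2 <= `|M|.
  by rewrite real_normK ?num_real //; have := ler_norm M; lra.
have := normr_ge0 (extI I z l); have := normr_ge0 M; nra.
Qed.

Lemma bounded_meval_extI {R : realType} {n : nat} (I : {set 'I_n})
    (K : set (#|I|.-tuple R)) (B : R) (p : poly_n R n) :
  (forall z l, K z -> `|extI I z l| <= B) ->
  exists C, forall z, K z -> `|mpoly.meval (extI I z) p| <= C.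
Proof.
move=> KB.
apply: (meval_closed (fun f => exists C, forall z, K z -> `|f z| <= C)).
- by move=> c; exists `|c|.
- move=> f h [C fC] [C' hC']; exists (C + C') => z Kz.
  by apply: le_trans (ler_normD _ _) _; rewrite lerD ?fC ?hC'.
- move=> f h [C fC] [C' hC']; exists (C * C') => z Kz.
  by rewrite normrM ler_pM ?fC ?hC'.
- by move=> l; exists B => z; exact: KB.
Qed.

Lemma integrable_meval_extI {R : realType} {n : nat} (I : {set 'I_n})
    (mu : {finite_measure set (#|I|.-tuple R) -> \bar R})
    (K : set (#|I|.-tuple R)) (B : R) (p : poly_n R n) :
  measurable K -> (forall z l, K z -> `|extI I z l| <= B) ->
  mu.-integrable K (fun z => (mpoly.meval (extI I z) p)%:E).
Proof.
move=> mK KB; apply: measurable_bounded_integrable => //.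
- by rewrite ltey_eq fin_num_measure.
- by apply: measurable_funS (measurable_meval_extI I p).
have [C pC] := bounded_meval_extI I K B p KB.
exists C; split; first exact: num_real.
by move=> x Cx z /= Kz; apply: le_trans (pC z Kz) (ltW Cx).
Qed.

(** The weights in [tree_sum_lower_bound] are the cell masses of [q_i dmu_i]; the cost of a cell is
    [p_i / q_i] at a point chosen so that, if the mass is positive, this quotient exceeds its
    average by at most [eta]. Lying in common cells on the overlaps keeps shared coordinates within
    [delta]. *)
Lemma near_feasible_points {R : realType} {n m N : nat}
  (p q : 'I_N -> poly_n R n) (g : 'I_m -> poly_n R n)
  (I : 'I_N -> {set 'I_n}) (J : 'I_N -> {set 'I_m}) (mu : meas_family R I)
  (B : R) :
  (0 < N)%N ->
  (forall i z l, Kloc g (I i) (J i) z -> `|extI (I i) z l| <= B) ->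
  (forall i : 'I_N, (0 < i)%N ->
     exists2 k : 'I_N, (k < i)%N &
       (I i :&: \bigcup_(j < N | (j < i)%N) I j \subset I k)%SET) ->
  (forall i z, Kloc g (I i) (J i) z -> 0 < mpoly.meval (extI (I i) z) (q i)) ->
  feasible p q g I J mu ->
  forall delta, 0 < delta -> exists z : forall i, #|I i|.-tuple R,
  [/\ forall i, Kloc g (I i) (J i) (z i),
      forall i j l, l \in I i -> l \in I j ->
        `|extI (I i) (z i) l - extI (I j) (z j) l| <= delta &
      \sum_(i < N) mpoly.meval (extI (I i) (z i)) (p i) /
                   mpoly.meval (extI (I i) (z i)) (q i) <=
      \sum_(i < N) fine (\int[mu i]_(z in Kloc g (I i) (J i))
                           (mpoly.meval (extI (I i) z) (p i))%:E) + delta].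
Proof.
move=> N0 KB RIP q_gt0 [_ [_ [mu1 mumarg]]] delta d0.
have [E [cell [mcell cellP]]] := finite_grid B delta d0.
(* Codes are indexed by all of ['I_n] to be comparable between blocks; outside [S] they take the
   value [cell 0]. *)
pose code (S : {set 'I_n}) (z : #|S|.-tuple R) : {ffun 'I_n -> E} := [ffun l => cell (extI S z l)].
pose e0 := cell 0.
have mcode (S : {set 'I_n}) c : measurable (code S @^-1` [set c]).
  rewrite (_ : code S @^-1` [set c] = \bigcap_(l in [set: 'I_n])
      ((fun z : #|S|.-tuple R => extI S z l) @^-1` (cell @^-1` [set c l]))).
    apply: fin_bigcap_measurable => // l _.
    by rewrite -[X in measurable X]setTI; apply: measurable_extI.
  apply/seteqP; split=> z /=.
    by move=> <- l _; rewrite /= ffunE.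
  by move=> zc; apply/ffunP => l; rewrite ffunE; exact: zc.
pose K i := Kloc g (I i) (J i).
pose Kc i c := K i `&` code (I i) @^-1` [set c].
have mK i : measurable (K i) by exact: measurable_Kloc.
have mKc i c : measurable (Kc i c) by exact: measurableI.
have intf i c (f : poly_n R n) :
    (mu i).-integrable (Kc i c) (fun z => (mpoly.meval (extI (I i) z) f)%:E).
  by apply: (integrable_meval_extI _ _ _ B) => // z l [Kz _]; exact: KB.
pose w i c := fine (\int[mu i]_(z in Kc i c) (mpoly.meval (extI (I i) z) (q i))%:E).
pose P i c := fine (\int[mu i]_(z in Kc i c) (mpoly.meval (extI (I i) z) (p i))%:E).
have wE i c : (\int[mu i]_(z in Kc i c) (mpoly.meval (extI (I i) z) (q i))%:E = (w i c)%:E)%E.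
  by rewrite /w fineK //; exact: (integrable_fin_num (mKc i c)).
have PE i c : (\int[mu i]_(z in Kc i c) (mpoly.meval (extI (I i) z) (p i))%:E = (P i c)%:E)%E.
  by rewrite /P fineK //; exact: (integrable_fin_num (mKc i c)).
have w0 i c : 0 <= w i c.
  apply: fine_ge0; apply: integral_ge0 => z [Kz _].
  by rewrite lee_fin ltW // q_gt0.
have wpart i (Q : pred {ffun 'I_n -> E}) :
    (\int[mu i]_(z in K i `&` [set z | Q (code (I i) z)]) (mpoly.meval (extI (I i) z) (q i))%:E
     = (\sum_(c | Q c) w i c)%:E)%E.
  rewrite integral_finite_partition;
    [|exact: mK|exact: mcode|exact: measurable_meval_extI].
  by rewrite -sumEFin; apply: eq_bigr => c _; exact: wE.
have w1 i : \sum_c w i c = 1.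
  apply: EFin_inj; rewrite -(wpart i predT) -[RHS](mu1 i); congr (integral _ _ _).
  by apply/seteqP; split=> z // [].
have Ppart i : fine (\int[mu i]_(z in K i) (mpoly.meval (extI (I i) z) (p i))%:E) =
    \sum_c P i c.
  rewrite (_ : K i = K i `&` [set z | predT (code (I i) z)]); last first.
    by apply/seteqP; split=> z // [].
  rewrite integral_finite_partition;
    [|exact: mK|exact: mcode|exact: measurable_meval_extI].
  by rewrite (eq_bigr (fun c => (P i c)%:E)) ?sumEFin // => c _; exact: PE.
have wI' (i j : 'I_N) b : (i < j)%N ->
     \sum_(c | restrict_coords e0 (I i :&: I j)%SET c == b) w i c =
     \sum_(c | restrict_coords e0 (I i :&: I j)%SET c == b) w j c.
  (* [Uset] omits empty overlaps; for these the only marginal is the total mass, which is 1 on both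
     sides. *)
  move=> ij; have [IJ0|IJn0] := eqVneq (I i :&: I j)%SET finset.set0.
    have rb c : restrict_coords e0 (I i :&: I j)%SET c = [ffun=> e0] :> {ffun 'I_n -> E}.
      by apply/ffunP => l; rewrite !ffunE IJ0 inE.
    under eq_bigl do rewrite rb; under [RHS]eq_bigl do rewrite rb.
    have [_|_] := eqVneq ([ffun=> e0] : {ffun 'I_n -> E}) b; last by rewrite !big_pred0_eq.
    by rewrite !w1.
  set S := (I i :&: I j)%SET.
  have jU : j \in Uset I i by rewrite inE ij.
  pose A : set (#|S|.-tuple R) := [set y | restrict_coords e0 S (code S y) == b].
  have mA : measurable A.
    rewrite (_ : A = \bigcup_(c in [set c | restrict_coords e0 S c == b]) (code S @^-1` [set c])).
      by apply: fin_bigcup_measurable => [|c _]; [exact: finite_finset|exact: mcode].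
    apply/seteqP; split=> y /=; first by exists (code S y).
    by move=> [c /= cb yc]; rewrite /A /= yc.
  have AE k : S \subset I k -> K k `&` [set z | restrict_coords e0 S (code (I k) z) == b] =
      K k `&` coord_proj (I k) S @^-1` A.
    move=> Sk; congr (_ `&` _); apply/funext => z; rewrite /A /=.
    congr (is_true (_ == b)); apply/ffunP => l; rewrite !ffunE.
    by case: ifPn => // lS; rewrite extI_coord_proj.
  have := mumarg i j jU A mA; rewrite -/S -!AE ?subsetIl ?subsetIr //.
  rewrite (wpart i (fun c => restrict_coords e0 S c == b)).
  by rewrite (wpart j (fun c => restrict_coords e0 S c == b)) => -[].
have wI (i j : 'I_N) b :
     \sum_(c | restrict_coords e0 (I i :&: I j)%SET c == b) w i c =
     \sum_(c | restrict_coords e0 (I i :&: I j)%SET c == b) w j c.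
  have [ij|ji|/val_inj ->//] := ltngtP i j; first exact: wI'.
  by rewrite finset.setIC (wI' j i b ji).
(* The denominator [N.+1] makes the total error [N * eta] strictly less than [delta]. *)
pose eta := delta / (N.+1)%:R.
have eta0 : 0 < eta by rewrite divr_gt0.
(* Multiplied by [w i c], the estimate also holds for cells of zero mass: there [P i c] vanishes too
   and any point will do. *)
have pts i c : exists z : #|I i|.-tuple R, (0 < w i c -> Kc i c z) /\
    (mpoly.meval (extI (I i) z) (p i) / mpoly.meval (extI (I i) z) (q i)) * w i c <=
    P i c + eta * w i c.
  have := w0 i c; rewrite le_eqVlt => /orP[/eqP w00|wc].
    exists [tuple 0 | _ < #|I i|]; rewrite -w00 !mulr0 addr0; split; first by rewrite ltxx.
    rewrite /P (integral_eq0_pos_weight _ _ _ _ _ _ (fun z => mpoly.meval (extI (I i) z) (q i))) //.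
    - exact: mKc.
    - exact: measurable_meval_extI.
    - exact: measurable_meval_extI.
    - by move=> z [Kz _]; exact: q_gt0.
    - by rewrite wE -w00.
  have [||||||z Kz zP] := quotient_le_average _ _ _ (mu i) (Kc i c)
    (fun z => mpoly.meval (extI (I i) z) (p i))
    (fun z => mpoly.meval (extI (I i) z) (q i)) eta => //.
  - exact: mKc.
  - exact: intf.
  - exact: intf.
  - by move=> z [Kz _]; exact: q_gt0.
  - by rewrite wE lte_fin.
  - by exists z; split.
pose zf i c := sval (cid (pts i c)).
have zfP i c := svalP (cid (pts i c)); rewrite -/(zf _ _) in zfP.
pose H i c := mpoly.meval (extI (I i) (zf i c)) (p i) / mpoly.meval (extI (I i) (zf i c)) (q i).
set V := \sum_(i < N) fine _.
(* Otherwise every consistent choice of cells of positive mass costs at least [V + delta], hence so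
   does the average, which is at most [V + N * eta]. *)
apply: contrapT => nz.
have allN (i : 'I_N) : (i <= N.-1)%N by rewrite -ltnS prednK.
have Nlt : (N.-1 < N)%N by rewrite prednK.
have := tree_sum_lower_bound R n N E e0 I w w0 w1 wI RIP N.-1 Nlt H (V + delta).
have -> : \sum_(i < N | (i <= N.-1)%N) \sum_c w i c * H i c =
    \sum_(i < N) \sum_c w i c * H i c.
  by apply: eq_bigl => i; rewrite allN.
have le1 : \sum_(i < N) \sum_c w i c * H i c <= V + N%:R * eta.
  rewrite /V -[N in N%:R](card_ord N) -sum1_card natr_sum mulr_suml -big_split /=.
  apply: ler_sum => i _; rewrite Ppart mul1r -[eta]mulr1 -(w1 i) mulr_sumr -big_split /=.
  by apply: ler_sum => c _; rewrite mulrC; case: (zfP i c).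
have lt1 : N%:R * eta < delta.
  by rewrite mulrA ltr_pdivrMr // mulrC ltr_pM2l // ltr_nat.
move=> /(_ _) H1; suff : V + delta <= \sum_(i < N) \sum_c w i c * H i c by lra.
apply: H1 => c cpos cagr.
rewrite leNgt; apply/negP => Hlt; apply: nz; exists (fun i => zf i (c i)).
have Kz i : Kc i (c i) (zf i (c i)) by apply: (zfP i (c i)).1; exact: cpos.
split.
- by move=> i; have [] := Kz i.
- move=> i j l li lj; apply: cellP.
  + by apply: KB; have [] := Kz i.
  + by apply: KB; have [] := Kz j.
  + have cE k : c k l = cell (extI (I k) (zf k (c k)) l).
      by have [_ /= /ffunP /(_ l) <-] := Kz k; rewrite ffunE.
    by rewrite -!cE; apply: cagr; rewrite ?allN // inE li lj.
- rewrite (eq_bigl predT) in Hlt; first exact: ltW.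
  by move=> i; rewrite allN.
Qed.

(** * Passage to the limit and conclusion *)

(** Any cluster point works: were [f t > b], then [f] would exceed [b + eps] near [t], while late
    terms stay below it. One [t] serves all [f] and [b], so consistency, constraints and cost pass
    to the limit together. *)
Lemma compact_limit_le {R : realType} {T : topologicalType} (A : set T)
    (u : nat -> T) :
  compact A -> (forall k, A (u k)) ->
  exists t, forall (f : T -> R) (b : R), {for t, continuous f} ->
    (forall k, f (u k) <= b + k.+1%:R^-1) -> f t <= b.
Proof.
move=> cA uA.
have [|t [_ clt]] := cA (u @ \oo) _.
  by exists 0%N => // k _; exact: uA.
exists t => f b cf fb; rewrite leNgt; apply/negP => bft.
pose eps := (f t - b) / 2.
have eps0 : 0 < eps by rewrite /eps; lra.
have nt : nbhs t [set y | f t - eps < f y].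
  have nb : nbhs t (f @^-1` ball (f t) eps) := cf _ (nbhsx_ballx (f t) eps eps0).
  apply: filterS nb => y /=.
  by rewrite /ball /= ltr_norml => /andP[_ fy]; lra.
have nu : (u @ \oo) (u @` [set k | (k.+1%:R^-1 : R) < eps]).
  have := near_infty_natSinv_lt (PosNum eps0); apply: filterS => k /= kd.
  by exists k.
have [_ [[k /= kd <-] /= fu]] := clt _ _ nu nt.
have : f (u k) < b + eps by apply: le_lt_trans (fb k) _; rewrite ltrD2l.
by rewrite /eps in fu *; lra.
Qed.

Lemma continuous_meval {R : realType} {n : nat} {T : topologicalType} (t : T)
    (F : T -> 'I_n -> R) (p : poly_n R n) :
  (forall l, {for t, continuous (F ^~ l)}) ->
  {for t, continuous (fun y => mpoly.meval (F y) p)}.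
Proof.
move=> cF; apply: (meval_closed (fun f => {for t, continuous f})) => //.
- by move=> c; exact: cvg_cst.
- by move=> f h cf ch; exact: continuousD.
- by move=> f h cf ch; exact: continuousM.
Qed.


Lemma continuous_at_sum {R : realType} {T : topologicalType} {K : Type} (t : T)
    (s : seq K) (f : K -> T -> R) :
  (forall i, {for t, continuous (f i)}) ->
  {for t, continuous (fun y => \sum_(i <- s) f i y)}.
Proof.
move=> cf; elim: s => [|i s IH].
  rewrite (_ : (fun y => _) = cst 0); first exact: cvg_cst.
  by apply/funext => y; rewrite big_nil.
rewrite (_ : (fun y => _) = (fun y => f i y + \sum_(j <- s) f j y)).
  exact: continuousD.
by apply/funext => y; rewrite big_cons.
Qed.

Lemma rho_le_feasible {R : realType} {n m N : nat}
  (p q : 'I_N -> poly_n R n) (g : 'I_m -> poly_n R n)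
  (I : 'I_N -> {set 'I_n}) (J : 'I_N -> {set 'I_m}) (mu : meas_family R I)
  (B : R) :
  (0 < N)%N ->
  (forall i z l, Kloc g (I i) (J i) z -> `|extI (I i) z l| <= B) ->
  (\bigcup_(i < N) I i = [set: 'I_n])%SET ->
  (\bigcup_(i < N) J i = [set: 'I_m])%SET ->
  (forall i, poly_in_vars (I i) (p i) /\ poly_in_vars (I i) (q i)) ->
  (forall i j, j \in J i -> poly_in_vars (I i) (g j)) ->
  (forall i : 'I_N, (0 < i)%N ->
     exists2 k : 'I_N, (k < i)%N &
       (I i :&: \bigcup_(j < N | (j < i)%N) I j \subset I k)%SET) ->
  (forall i z, Kloc g (I i) (J i) z -> 0 < mpoly.meval (extI (I i) z) (q i)) ->
  feasible p q g I J mu ->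
  (rho p q g <= \sum_(i < N) \int[mu i]_(z in Kloc g (I i) (J i))
                        (mpoly.meval (extI (I i) z) (p i))%:E)%E.
Proof.
move=> N0 KB Iall Jall pqI gI RIP q_gt0 fmu.
pose P i := fine (\int[mu i]_(z in Kloc g (I i) (J i)) (mpoly.meval (extI (I i) z) (p i))%:E).
have PE i : (\int[mu i]_(z in Kloc g (I i) (J i)) (mpoly.meval (extI (I i) z) (p i))%:E = (P i)%:E)%E.
  have mK := measurable_Kloc g (I i) (J i).
  rewrite /P fineK //; apply: (integrable_fin_num mK).
  by apply: (integrable_meval_extI _ _ _ B) => // z l; exact: KB.
rewrite (eq_bigr (fun i => (P i)%:E)) => [|i _]; last exact: PE.
rewrite sumEFin.
have inv_k_gt0 k : (0 : R) < k.+1%:R^-1 by rewrite invr_gt0.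
have approx k := near_feasible_points p q g I J mu B N0 KB RIP q_gt0 fmu
  _ (inv_k_gt0 k).
pose z k := sval (cid (approx k)).
have zP k := svalP (cid (approx k)); rewrite -/(z _) -/P in zP.
(* Each block keeps its own copy of the coordinates, since the copies need agree only in the
   limit. *)
pose X := prod_topology (fun _ : 'I_N * 'I_n => R).
pose u k : X := fun il => extI (I il.1) (z k il.1) il.2.
have cbox : compact [set y : X | forall il, `[- B, B]%classic (y il)].
  by apply: (@tychonoff _ (fun=> R) (fun=> `[- B, B]%classic)) => il; exact: segment_compact.
have [|t tP] := @compact_limit_le R X _ u cbox.
  move=> k il /=; rewrite in_itv /= -ler_norml; apply: KB.
  by case: (zP k).
have ct i l : {for t, continuous (fun y : X => y (i, l))}.
  exact: (@proj_continuous _ (fun=> R) (i, l) t).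
have eqt i j l : l \in I i -> l \in I j -> t (i, l) = t (j, l).
  move=> li lj; apply/eqP; rewrite -subr_eq0 -normr_le0.
  apply: (tP (fun y : X => `|y (i, l) - y (j, l)|)).
    apply: continuous_comp; last exact: norm_continuous.
    by apply: continuousB.
  by move=> k; rewrite add0r; case: (zP k) => _ + _; apply.
have gt i j : j \in J i -> 0 <= mpoly.meval (fun l => t (i, l)) (g j).
  move=> jJ; rewrite -oppr_le0.
  apply: (tP (fun y : X => - mpoly.meval (fun l => y (i, l)) (g j))).
    by apply: continuousN; apply: continuous_meval => l; exact: ct.
  move=> k; rewrite add0r (le_trans _ (_ : 0 <= _)) // oppr_le0.
  by case: (zP k) => + _ _; apply.
have in_cover l : exists i, l \in I i.
  have : l \in (\bigcup_(i < N) I i)%SET by rewrite Iall inE.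
  by move=> /bigcupP[i _ li]; exists i.
(* Any block containing [l] may supply the coordinate, by [eqt]. *)
pose x l := t (sval (cid (in_cover l)), l).
have xE i : {in I i, x =1 fun l => t (i, l)}.
  by move=> l li; apply: eqt => //; exact: svalP (cid (in_cover l)).
have Kx : Kset g x.
  move=> j; have : j \in (\bigcup_(i < N) J i)%SET by rewrite Jall inE.
  by move=> /bigcupP[i _ ji]; rewrite (eq_meval_in _ _ _ (gI i j ji) (xE i)) gt.
(* Strict positivity need not survive a limit; it holds because the limit point lies in [K_i]. It
   makes the quotient continuous at [t]. *)
have qt i : 0 < mpoly.meval (fun l => t (i, l)) (q i).
  have exE := @extI_mktuple R n (I i) (fun l => t (i, l)).
  rewrite -(eq_meval_in _ _ _ (pqI i).2 exE); apply: q_gt0 => j ji.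
  by rewrite (eq_meval_in _ _ _ (gI i j ji) exE) gt.
apply: (@le_trans _ _ (\sum_(i < N) mpoly.meval x (p i) / mpoly.meval x (q i))%:E).
  by apply: ereal_inf_lbound; exists x.
rewrite lee_fin (eq_bigr (fun i => mpoly.meval (fun l => t (i, l)) (p i) /
    mpoly.meval (fun l => t (i, l)) (q i))) => [|i _]; last first.
  by rewrite (eq_meval_in _ _ _ (pqI i).1 (xE i)) (eq_meval_in _ _ _ (pqI i).2 (xE i)).
apply: (tP (fun y : X => \sum_(i < N) mpoly.meval (fun l => y (i, l)) (p i) /
    mpoly.meval (fun l => y (i, l)) (q i))); last by move=> k; case: (zP k).
apply: continuous_at_sum => i; apply: continuousM.
  by apply: continuous_meval => l; exact: ct.
apply: continuousV; first by rewrite gt_eqF.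
by apply: continuous_meval => l; exact: ct.
Qed.

(* Indices are 0-based: [n] = 'I_n, [m] = 'I_m, [N] = 'I_N. *)
Theorem theorem4p14 (R : realType) (n m N : nat)
  (p q : 'I_N -> poly_n R n) (g : 'I_m -> poly_n R n)
  (I : 'I_N -> {set 'I_n}) (J : 'I_N -> {set 'I_m}) :
  (0 < n)%N -> (0 < m)%N -> (0 < N)%N ->
  (* K compact *)
  compact [set v : 'rV[R]_n | Kset g (fun l => v ord0 l)] ->
  (* q_i > 0 on K *)
  (forall i x, Kset g x -> 0 < mpoly.meval x (q i)) ->
  (* [n] = U_i I_i, [m] = U_i J_i *)
  (\bigcup_(i < N) I i = [set: 'I_n])%SET ->
  (\bigcup_(i < N) J i = [set: 'I_m])%SET ->
  (* (i) *)
  (forall i, poly_in_vars (I i) (p i) /\ poly_in_vars (I i) (q i)) ->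
  (* (ii) *)
  (forall i j, j \in J i -> poly_in_vars (I i) (g j)) ->
  (* (iii) *)
  (forall i, exists2 k, k \in J i & exists2 M : R, 0 < M & g k = ball_poly (I i) M) ->
  (* (iv) running intersection property *)
  (forall i : 'I_N, (0 < i)%N ->
     exists2 k : 'I_N, (k < i)%N &
       (I i :&: \bigcup_(j < N | (j < i)%N) I j \subset I k)%SET) ->
  (* q_i > 0 on K_i *)
  (forall i z, Kloc g (I i) (J i) z -> 0 < mpoly.meval (extI (I i) z) (q i)) ->
  rho_cs p q g I J = rho p q g.
Proof.
move=> n0 m0 N0 _ _ Iall Jall pqI gI ballJ RIP q_gt0.
have [B KB] : exists B : R, forall i z l, Kloc g (I i) (J i) z ->
    `|extI (I i) z l| <= B.
  have /choice[b bP] : forall i, exists b : R, forall z, Kloc g (I i) (J i) z ->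
      forall l, `|extI (I i) z l| <= b.
    move=> i; have [k kJ [M _ gk]] := ballJ i.
    by exists (`|M| + 1); exact: Kloc_bounded kJ gk.
  exists (\sum_(i < N) `|b i|) => i z l Kz.
  apply: le_trans (bP i z Kz l) (le_trans (ler_norm _) _).
  by rewrite (bigD1 i) //= lerDl sumr_ge0.
apply/eqP; rewrite eq_le; apply/andP; split.
  apply/ereal_infP => _ [x Kx <-].
  apply: rho_cs_le_point => // i.
  (* The restriction of [x] to [I i] lies in [K_i], where [q i] is positive. *)
  have exE := @extI_mktuple R n (I i) x.
  rewrite -(eq_meval_in _ _ _ (pqI i).2 exE); apply: q_gt0 => j ji.
  by rewrite (eq_meval_in _ _ _ (gI i j ji) exE); exact: Kx.
apply/ereal_infP => _ [mu [fmu ->]].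
exact: (rho_le_feasible _ _ _ _ _ _ B).
Qed.
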